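(* Let $\mathcal M\subseteq\{0,1\}^D$ be the family of observed index sets (masks), and let $\mu\in\mathcal P(\mathcal M)$ be a positive probability distribution of observed indices. For a joint distribution $p^n\in\mathcal P(\mathcal X)$, define the exact Impute-EM update $$p^{n+1}(x)=\mathbb E_{m\sim\mu}\left[p_m^*(x_m)\,p^n(\overline{x}_m\mid x_m)\right],$$ where $p_m^*$ denotes the target marginal on the observed coordinates indexed by $m$.
   Context: The data space is $\mathcal X=\mathbb R^{d_1}\times\prod_{\ell=1}^{d_2}\mathcal S_\ell$, where each $\mathcal S_\ell$ is a finite discrete set, and $D=d_1+d_2$; a point is written $x=(x^{(1)},\dots,x^{(D)})$. $\mathcal P(\mathcal X)$ is the set of probability distributions on $\mathcal X$, and $\mathcal P(\mathcal M)$ the set of probability distributions on $\mathcal M$. A mask is a vector $m\in\{0,1\}^D$; $m_j=1$ means that coordinate $j$ is observed and $m_j=0$ that it is missing. Write $x_m=\{x^{(j)}:m_j=1\}$ for the observed coordinates and $\overline{x}_m=\{x^{(j)}:m_j=0\}$ for the missing coordinates. For $p\in\mathcal P(\mathcal X)$, $p_m$ denotes its marginal distribution on the observed coordinates indexed by $m$, and $p(\overline{x}_m\mid x_m)$ the conditional distribution of the missing coordinates given the observed ones. $p^*\in\mathcal P(\mathcal X)$ is the data distribution, and $p_m^*$ is its marginal on the coordinates $x_m$. Positive means $\mu(m)>0$ for every $m\in\mathcal M$. Impute-EM is the name of the procedure that alternates an Expectation step, $q^n(\overline{x}_m\mid x_m)\leftarrow p^n(\overline{x}_m\mid x_m)$,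 and a Maximization step, $p^{n+1}\leftarrow\operatorname{argmax}_p\,\mathbb E_{m\sim\mu,\;x_m\sim p_m^*,\;\overline{x}_m\sim q^n(\overline{x}_m\mid x_m)}\left[\log p(\overline{x}_m,x_m)\right]$; the display in the claim is given as the closed-form update operator of this procedure in the idealized setting of exact E-step sampling and exact M-step maximization. *)

(* Defs.v *)
From HB Require Import structures.
From mathcomp Require Import all_boot all_order all_algebra.
From mathcomp Require Import all_classical all_reals all_analysis.
From mathcomp Require Import measurable_realfun.

Set Implicit Arguments.
Unset Strict Implicit.
Unset Printing Implicit Defensive.

Import Order.TTheory GRing.Theory Num.Theory.
Import numFieldNormedType.Exports.

Local Open Scope classical_set_scope.
Local Open Scope ring_scope.
Local Open Scope ereal_scope.

(* measurable types are pointed in MathComp-Analysis; for a factor S_l this only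
   says that it is nonempty, without which there is no probability on the data
   space *)
#[short(type="pointedFinType")]
HB.structure Definition PointedFinite := {T of Finite T & isPointed T}.

Definition discrete_space (S : pointedFinType) : Type := S.
HB.instance Definition _ (S : pointedFinType) := Pointed.on (discrete_space S).
HB.instance Definition _ (S : pointedFinType) :=
  @isMeasurable.Build default_measure_display (discrete_space S)
    discrete_measurable discrete_measurable0
    discrete_measurableC discrete_measurableU.

Definition dprod_display : measure_display -> measure_display.
Proof. exact. Qed.

Section dependent_product.
Context (I : Type) (d : measure_display) (T : I -> measurableType d).

Definition cylinders : set (set (forall i, T i)) :=
  \bigcup_i preimage_set_system setT (fun x : forall i, T i => x i) measurable.

Definition dprod : Type := forall i, T i.
HB.instance Definition _ := Pointed.on dprod.

Let dprod0 : <<s cylinders >> set0. Proof. exact: sigma_algebra0. Qed.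

Let dprodC (A : set dprod) : <<s cylinders >> A -> <<s cylinders >> (~` A).
Proof. exact: sigma_algebraC. Qed.

Let dprodU (F : (set dprod)^nat) :
  (forall n, <<s cylinders >> (F n)) -> <<s cylinders >> (\bigcup_n F n).
Proof. exact: sigma_algebra_bigcup. Qed.

HB.instance Definition _ := @isMeasurable.Build (dprod_display d) dprod
  <<s cylinders >> dprod0 dprodC dprodU.

Lemma measurable_dprod_proj i : measurable_fun setT (fun x : dprod => x i).
Proof.
move=> _ A mA; apply: sub_sigma_algebra.
by exists i => //; exists A.
Qed.

Lemma measurable_dprodP d' (U : measurableType d') (f : U -> dprod) :
  (forall i, measurable_fun setT (fun u => f u i)) -> measurable_fun setT f.
Proof.
move=> mf; apply: (@measurability _ _ U dprod setT f cylinders) => [|B] //.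
move=> [_ [i _ [A mA <-]] <-{B}].
rewrite setTI setTI -comp_preimage -[X in measurable X]setTI.
exact: mf.
Qed.
End dependent_product.

Section kernel_image.
Context d d' d'' (U : measurableType d) (V : measurableType d')
  (X : measurableType d'') (R : realType).
Variables (P : probability U R) (q : R.-pker U ~> V) (g : U -> V -> X).
Hypothesis mg : measurable_fun setT (fun w : U * V => g w.1 w.2).

(* law of g u v when u ~ P and v ~ q(. | u) *)
Definition kernel_image (A : set X) : \bar R := \int[P]_u q u (g u @^-1` A).

Let mslice u A : measurable A -> measurable (g u @^-1` A).
Proof.
move=> mA; rewrite -[X in measurable X]setTI.
have mgu : measurable_fun setT (g u).
  exact: (measurableT_comp mg (pair1_measurable u)).
exact: (mgu measurableT).
Qed.

Let slice A (u : U) : \bar R := q u (g u @^-1` A).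

Let measurable_slice A : measurable A -> measurable_fun setT (slice A).
Proof.
move=> mA.
have mB : measurable ((fun w : U * V => g w.1 w.2) @^-1` A).
  by rewrite -[X in measurable X]setTI; exact: mg.
have := measurable_fun_xsection_finite_kernel q (mem_set mB).
by rewrite (_ : (fun x => _) = slice A)//; apply/funext => u; rewrite xsectionE.
Qed.

Lemma kernel_image0 : kernel_image set0 = 0.
Proof. by apply: integral0_eq => u _; rewrite preimage_set0 measure0. Qed.

Lemma kernel_image_ge0 A : 0 <= kernel_image A.
Proof. exact: integral_ge0. Qed.

Lemma kernel_image_sigma_additive : semi_sigma_additive kernel_image.
Proof.
move=> F mF tF mUF; rewrite [X in _ --> X](_ : _ =
    \int[P]_u (\sum_(n <oo) q u (g u @^-1` F n))); last first.
  apply: eq_integral => u _; rewrite preimage_bigcup measure_semi_bigcup//.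
  - by move=> n; exact: mslice.
  - apply/trivIsetP => i j _ _ ij; rewrite -preimage_setI.
    by move/trivIsetP : tF => /(_ i j Logic.I Logic.I ij) ->; rewrite preimage_set0.
  - by rewrite -preimage_bigcup; exact: mslice.
rewrite integral_nneseries//.
- by apply: is_cvg_nneseries => n _ _; exact: integral_ge0.
- by move=> n; exact: (measurable_slice (mF n)).
Qed.
End kernel_image.

Section impute_em.
Context (R : realType) (d1 d2 : nat) (S : 'I_d2 -> pointedFinType).

Local Notation D := (d1 + d2)%N.

(* the first d1 coordinates are real, the last d2 are discrete *)
Definition coord_space (j : 'I_D) : measurableType default_measure_display :=
  match fintype.split j with
  | inl _ => R
  | inr l => discrete_space (S l)
  end.

Definition data_space : measurableType (dprod_display default_measure_display) :=
  dprod coord_space.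

Definition block (A : pred 'I_D) :
    measurableType (dprod_display default_measure_display) :=
  dprod (fun j : {j : 'I_D | A j} => coord_space (val j)).

Definition restrict_to (A : pred 'I_D) (x : data_space) : block A :=
  fun j => x (val j).

Lemma measurable_restrict_to A : measurable_fun setT (@restrict_to A).
Proof. by apply: measurable_dprodP => j; exact: measurable_dprod_proj. Qed.

HB.instance Definition _ (A : pred 'I_D) :=
  isMeasurableFun.Build _ _ _ _ (@restrict_to A) (@measurable_restrict_to A).

Definition mask_vec := {ffun 'I_D -> bool}.

Definition observed (m : mask_vec) :
    measurableType (dprod_display default_measure_display) :=
  block m.
Definition missing (m : mask_vec) :
    measurableType (dprod_display default_measure_display) :=
  block (fun j => ~~ m j).

Definition obs (m : mask_vec) : {mfun data_space >-> observed m} :=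
  @restrict_to m.
Definition mis (m : mask_vec) : {mfun data_space >-> missing m} :=
  @restrict_to (fun j => ~~ m j).

(* the point x with x_m = u and \overline{x}_m = v *)
Definition join_coords (m : mask_vec) (u : observed m) (v : missing m) : data_space :=
  fun j => match boolP (m j) with
           | AltTrue h => u (exist _ j h)
           | AltFalse h => v (exist _ j h)
           end.

Lemma join_coordsK (m : mask_vec) (x : data_space) : join_coords (obs m x) (mis m x) = x.
Proof.
by apply: functional_extensionality_dep => j; rewrite /join_coords; destruct (boolP (m j)).
Qed.

Lemma measurable_join_coords (m : mask_vec) :
  measurable_fun setT (fun w : observed m * missing m => join_coords w.1 w.2).
Proof.
apply: measurable_dprodP => j; rewrite /join_coords.
destruct (boolP (m j)) as [h|h].
- have mu : measurable_fun setT (fun u : observed m => u (exist _ j h)).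
    exact: (@measurable_dprod_proj _ _ (fun j : {j | m j} => coord_space (val j))).
  exact: (measurableT_comp mu (@measurable_fst _ _ (observed m) (missing m))).
- have mv : measurable_fun setT (fun v : missing m => v (exist _ j h)).
    exact: (@measurable_dprod_proj _ _ (fun j : {j | ~~ m j} => coord_space (val j))).
  exact: (measurableT_comp mv (@measurable_snd _ _ (observed m) (missing m))).
Qed.

Record mask_dist (M : {set mask_vec}) := MaskDist {
  mask_weight :> mask_vec -> R ;
  mask_weight_ge0 : forall m, m \in M -> (0 <= mask_weight m)%R ;
  mask_weight_sum1 : (\sum_(m in M) mask_weight m = 1)%R }.

Definition marginal (p : probability data_space R) (m : mask_vec) :
  probability (observed m) R := distribution p (obs m).

(* q is a version of p(\overline{x}_m | x_m) *)
Definition is_conditional (p : probability data_space R) (m : mask_vec)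
    (q : R.-pker observed m ~> missing m) : Prop :=
  forall (A : set (observed m)) (B : set (missing m)),
    measurable A -> measurable B ->
    p (obs m @^-1` A `&` mis m @^-1` B) = \int[marginal p m]_(u in A) q u B.

(* law of x when x_m ~ p_m and \overline{x}_m ~ q(. | x_m) *)
Definition completed_law (p : probability data_space R) (m : mask_vec)
    (q : R.-pker observed m ~> missing m) : set data_space -> \bar R :=
  kernel_image (marginal p m) q (@join_coords m).

HB.instance Definition _ p m (q : R.-pker observed m ~> missing m) :=
  isMeasure.Build _ _ _ (completed_law p q) (kernel_image0 _ _ _)
    (kernel_image_ge0 _ _ _)
    (kernel_image_sigma_additive (@measurable_join_coords m)).

Lemma completed_law_setT p m (q : R.-pker observed m ~> missing m) :
  completed_law p q setT = 1.
Proof.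
rewrite /completed_law /kernel_image.
under eq_integral do rewrite preimage_setT prob_kernel.
rewrite integral_cst// mul1e; exact: (@probability_setT _ _ _ (marginal p m)).
Qed.

HB.instance Definition _ p m (q : R.-pker observed m ~> missing m) :=
  Measure_isProbability.Build _ _ _ (completed_law p q) (completed_law_setT p q).

(* E_{m ~ mu}[pstar_m(x_m) q(\overline{x}_m | x_m)], as a measure on the data space *)
Definition impute_em_update (M : {set mask_vec}) (mu : mask_dist M)
    (pstar : probability data_space R)
    (q : forall m, R.-pker observed m ~> missing m)
    (A : set data_space) : \bar R :=
  \sum_(m in M) (mu m)%:E *
    \int[marginal pstar m]_u q m u [set v | A (join_coords u v)].

(* logarithm of the density of p with respect to the reference measure lam
   (Lebesgue x counting in the usual reading of log p); -oo where the density
   vanishes *)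
Definition log_density (lam : {sigma_finite_measure set data_space -> \bar R})
    (p : probability data_space R) (x : data_space) : \bar R :=
  lne (Radon_Nikodym (charge_of_finite_measure p) lam x).

(* E_{m ~ mu, x_m ~ pstar_m, \overline{x}_m ~ q}[log p(x)]; as +oo - oo = -oo, an
   expectation that is undefined counts as -oo *)
Definition mstep_objective (M : {set mask_vec}) (mu : mask_dist M)
    (pstar : probability data_space R)
    (q : forall m, R.-pker observed m ~> missing m)
    (lam : {sigma_finite_measure set data_space -> \bar R})
    (p : probability data_space R) : \bar R :=
  \sum_(m in M) (mu m)%:E * \int[completed_law pstar (q m)]_x log_density lam p x.

Definition is_mstep (M : {set mask_vec}) (mu : mask_dist M)
    (pstar : probability data_space R)
    (q : forall m, R.-pker observed m ~> missing m)
    (lam : {sigma_finite_measure set data_space -> \bar R})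
    (p : probability data_space R) : Prop :=
  p `<< lam /\
  forall p' : probability data_space R, p' `<< lam ->
    mstep_objective mu pstar q lam p' <= mstep_objective mu pstar q lam p.

End impute_em.

(* Main.v *)
(* The update P is the mixture of the completed laws c_m, m in M, so the M-step
   objective of p is the integral of log (dp/dlam) against P.  With f = dp/dlam and
   g = dP/dlam, ln t <= t - 1 gives log f <= log g + f/g - 1, where f/g has P-integral
   at most 1: this is Gibbs' inequality, so P maximizes the objective.  If p attains the
   same finite value then f = g P-almost everywhere, hence P <= p and P = p.
   Two versions of the conditional law agree almost everywhere on each measurable set,
   hence yield the same joint law on rectangles, and so the same completed law. *)
Require Import Defs.
From HB Require Import structures.
From mathcomp Require Import all_boot all_order all_algebra.
From mathcomp Require Import all_classical all_reals all_analysis.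
From mathcomp Require Import measurable_realfun.
From mathcomp Require Import lra.

Set Implicit Arguments.
Unset Strict Implicit.
Unset Printing Implicit Defensive.

Import Order.TTheory GRing.Theory Num.Theory.
Import numFieldNormedType.Exports.

Local Open Scope classical_set_scope.
Local Open Scope ring_scope.
Local Open Scope ereal_scope.

(** * Finite mixtures of probability measures *)

Section probability_of_measure.
Context d (T : measurableType d) (R : realType).
Variable m : {measure set T -> \bar R}.

(** An alias of [m] carrying the proof of unit mass, so that a probability instance can be attached
    to it. *)
Definition unit_mass_measure of m setT = 1 : set T -> \bar R := m.

Hypothesis mT : m setT = 1.

HB.instance Definition _ := Measure.on (unit_mass_measure mT).
HB.instance Definition _ :=
  Measure_isProbability.Build _ _ _ (unit_mass_measure mT) mT.

Lemma probability_of_measure :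
  exists P : probability T R, forall A, P A = m A.
Proof. by exists (unit_mass_measure mT). Qed.
End probability_of_measure.

Section mixture.
Context d (T : measurableType d) (R : realType) (I : finType).
Implicit Types (w : I -> R) (c : I -> {measure set T -> \bar R}).

Lemma measure_combination (s : seq I) w c :
    (forall i, i \in s -> (0 <= w i)%R) ->
  exists m : {measure set T -> \bar R},
    (forall A, m A = \sum_(i <- s) (w i)%:E * c i A) /\
    (forall f, measurable_fun setT f -> (forall x, 0 <= f x) ->
      \int[m]_x f x = \sum_(i <- s) (w i)%:E * \int[c i]_x f x).
Proof.
elim: s => [_|i s IH w0].
  exists mzero; split=> [A|f mf f0]; rewrite big_nil//.
  by rewrite integral_measure_zero.
have [|m [mE mI]] := IH; first by move=> j js; apply: w0; rewrite inE js orbT.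
have wi0 : (0 <= w i)%R by apply: w0; rewrite mem_head.
exists (measure_add (mscale (NngNum wi0) (c i)) m); split=> [A|f mf f0].
  by rewrite [LHS]measure_addE big_cons -mE.
by rewrite ge0_integral_measure_add// ge0_integral_mscale// big_cons mI.
Qed.

Lemma mixture_probability (M : {set I}) w (c : I -> probability T R) :
    (forall i, i \in M -> (0 <= w i)%R) -> (\sum_(i in M) w i = 1)%R ->
  exists P : probability T R,
    (forall A, P A = \sum_(i in M) (w i)%:E * c i A) /\
    (forall f, measurable_fun setT f -> (forall x, 0 <= f x) ->
      \int[P]_x f x = \sum_(i in M) (w i)%:E * \int[c i]_x f x).
Proof.
move=> w0 w1; have [|m [mE mI]] := @measure_combination (enum M) w c.
  by move=> i; rewrite mem_enum => /w0.
have mT : m setT = 1.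
  rewrite mE big_enum/= (eq_bigr (fun i => (w i)%:E)); last first.
    by move=> i _; rewrite [X in _ * X]probability_setT mule1.
  by rewrite sumEFin w1.
have [P Pm] := probability_of_measure mT.
exists P; split=> [A|f mf f0]; first by rewrite Pm mE big_enum.
by rewrite (eq_measure_integral m) ?mI ?big_enum// => A _ _; exact: Pm.
Qed.

(* No integrability is needed: with [+oo - oo = -oo], an undefined integral on
   either side makes both sides equal to [-oo]. *)
Lemma integral_mixture (M : {set I}) w (c : I -> probability T R)
    (P : probability T R) (f : T -> \bar R) :
    (forall i, i \in M -> (0 < w i)%R) ->
    (forall g, measurable_fun setT g -> (forall x, 0 <= g x) ->
      \int[P]_x g x = \sum_(i in M) (w i)%:E * \int[c i]_x g x) ->
    measurable_fun setT f ->
  \sum_(i in M) (w i)%:E * \int[c i]_x f x = \int[P]_x f x.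
Proof.
move=> w0 PI mf; rewrite integralE !PI//; last 2 first.
  exact: measurable_funeneg.
  exact: measurable_funepos.
rewrite -sumeN; last first.
  move=> i j iM jM; apply: ge0_adde_def; rewrite inE mule_ge0// ?integral_ge0//;
  by rewrite lee_fin ltW// w0.
rewrite -big_split/=; apply: eq_bigr => i iM; rewrite integralE.
have := integral_ge0 (D := setT) (c i) (fun x _ => funepos_ge0 f x).
have := integral_ge0 (D := setT) (c i) (fun x _ => funeneg_ge0 f x).
have wi := w0 i iM.
(* A positive weight keeps infinite parts infinite, so each term splits in all four cases,
   [+oo - oo] included. *)
case: (\int[c i]_x f^\- x) => [b| |]// _;
  case: (\int[c i]_x f^\+ x) => [a| |]// _.
- by rewrite -EFinB -!EFinM mulrBr EFinB.
- by rewrite addye// -EFinM gt0_muley ?lte_fin// addye.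
- by rewrite addeNy gt0_muleNy ?lte_fin// gt0_muley ?lte_fin// addeNy.
- by rewrite addeNy gt0_muleNy ?lte_fin// gt0_muley ?lte_fin// addeNy.
Qed.

End mixture.

(** * Laws generated by almost everywhere equal kernels *)

Section kernel_image_unique.
Context d d' (U : measurableType d) (V : measurableType d') (R : realType).
Implicit Types (P : probability U R) (q : R.-pker U ~> V).

Let measurable_pair : measurable_fun setT (fun w : U * V => (w.1, w.2)).
Proof.
rewrite (_ : (fun w => _) = id); first exact: measurable_id.
by apply/funext => -[].
Qed.

Definition kernel_joint P q : set (U * V) -> \bar R := kernel_image P q pair.

HB.instance Definition _ P q := isMeasure.Build _ _ _ (kernel_joint P q)
  (kernel_image0 P q pair) (kernel_image_ge0 P q pair)
  (@kernel_image_sigma_additive _ _ _ _ _ _ _ P q _ measurable_pair).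

Let kernel_joint_rect P q A B :
  kernel_joint P q (A `*` B) = \int[P]_u (if u \in A then q u B else 0).
Proof.
apply: eq_integral => u _; case: ifPn => [/set_mem Au|/negP uA].
  by congr (q u _); apply/seteqP; split=> [v []//|v Bv]; split.
rewrite (_ : _ @^-1` _ = set0) ?measure0//.
by apply/seteqP; split=> // v [/= Au _]; apply: uA; exact/mem_set.
Qed.

Let measurable_rect q A B : measurable A -> measurable B ->
  measurable_fun setT (fun u => if u \in A then q u B else 0).
Proof.
move=> mA mB; apply: measurable_fun_ifT => //.
- apply: (measurable_fun_bool true); rewrite setTI.
  rewrite (_ : _ @^-1` _ = A)//.
  by apply/seteqP; split=> u /=; [move/set_mem|move/mem_set].
- exact: measurable_kernel.
Qed.

(* The exceptional null set may depend on [B]: the two joint laws agree on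
   rectangles, hence everywhere. *)
Lemma eq_kernel_image P q q' d'' (X : measurableType d'') (g : U -> V -> X) :
    measurable_fun setT (fun w : U * V => g w.1 w.2) ->
    (forall B, measurable B -> ae_eq P setT (q ^~ B) (q' ^~ B)) ->
  forall A, measurable A -> kernel_image P q g A = kernel_image P q' g A.
Proof.
move=> mg qq' A mA.
suff joint_eq C : measurable C -> kernel_joint P q C = kernel_joint P q' C.
  (* By unfolding, [kernel_image P q g A] is the joint law of the preimage of [A] under [g]. *)
  apply: (joint_eq ((fun w => g w.1 w.2) @^-1` A)).
  by rewrite -[X in measurable X]setTI; exact: mg.
pose G := [set A `*` B | A in @measurable _ U & B in @measurable _ V].
apply: (measure_unique G (fun=> setT)).
- exact: measurable_prod_measurableType.
- move=> _ _ [A1 mA1 [B1 mB1 <-]] [A2 mA2 [B2 mB2 <-]]; rewrite -setXI.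
  exists (A1 `&` A2); first exact: measurableI.
  by exists (B1 `&` B2) => //; exact: measurableI.
- by move=> _; exists setT => //; exists setT => //; rewrite setXTT.
- by rewrite bigcup_const//; exists 0%N.
- move=> _ [A1 mA1 [B1 mB1 <-]].
  rewrite [LHS]kernel_joint_rect [RHS]kernel_joint_rect.
  apply: ge0_ae_eq_integral => //.
  + exact: measurable_rect.
  + exact: measurable_rect.
  + by move=> u _; case: ifP.
  + by move=> u _; case: ifP.
  + by apply: filterS (qq' _ mB1) => u /= qu _; case: ifP => // _; exact: qu.
- move=> _; rewrite -setXTT [ltLHS]kernel_joint_rect.
  under eq_integral do rewrite in_setT prob_kernel.
  by rewrite integral_cst//= mul1e probability_setT ltry.
Qed.

End kernel_image_unique.

(** * Independence from the version of the conditional law *)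

Section conditional_unique.
Context (R : realType) (d1 d2 : nat) (S : 'I_d2 -> pointedFinType).
Context (p pstar : probability (data_space R d1 S) R) (m : mask_vec d1 d2).
Context (q q' : R.-pker observed R S m ~> missing R S m).
Hypotheses (pq : is_conditional p q) (pq' : is_conditional p q').

(** Over each measurable [A] both kernels integrate to the same joint probability under [p]. Being
    bounded by 1 they are integrable, so these equalities determine them almost everywhere. *)
Lemma is_conditional_ae_eq B : measurable B ->
  ae_eq (marginal p m) setT (q ^~ B) (q' ^~ B).
Proof.
move=> mB; apply: integral_ae_eq => //.
- apply: (@le_integrable _ _ _ _ _ _ _ (EFin \o cst 1%R)) => //.
  + exact: measurable_kernel.
  + move=> u _ /=; rewrite gee0_abs// normr1.
    by rewrite -(@prob_kernel _ _ _ _ _ q u) le_measure// inE.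
  + exact: finite_measure_integrable_cst.
- exact: measurable_kernel.
- by move=> A _ mA; rewrite -pq// -pq'.
Qed.

(** The versions agree off a null set of [marginal p m], whereas [completed_law] integrates against
    [marginal pstar m]; domination transfers the null set. *)
Lemma eq_completed_law : marginal pstar m `<< marginal p m ->
  forall A, measurable A -> completed_law pstar q A = completed_law pstar q' A.
Proof.
move=> pp A mA; apply: eq_kernel_image => //; first exact: measurable_join_coords.
move=> B mB; apply: null_dominates_ae_eq pp _ => //.
exact: is_conditional_ae_eq.
Qed.

End conditional_unique.

(** * Gibbs' inequality and its equality case, in abstract form *)

Section gibbs.
Context d (T : measurableType d) (R : realType) (P : probability T R).

Lemma integrable_of_posneg (f : T -> \bar R) : measurable_fun setT f ->
  \int[P]_x f^\+ x < +oo -> \int[P]_x f^\- x < +oo -> P.-integrable setT f.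
Proof.
move=> mf fp fn; apply/integrableP; split=> //.
under eq_integral do rewrite -/((abse \o f) _) fune_abse.
by rewrite ge0_integralD//; [exact: lte_add_pinfty|exact: measurable_funepos|
  exact: measurable_funeneg].
Qed.

(* The hypotheses abstract [F = log f], [G = log g] and [h = f / g] for densities [f]
   and [g], where [P] has density [g], so that [FGh] is [ln h <= h - 1]. *)
Context (F : T -> \bar R) (G h : T -> R).
Hypotheses (mF : measurable_fun setT F) (mG : measurable_fun setT G)
  (mh : measurable_fun setT h) (h0 : forall x, (0 <= h x)%R)
  (int_h : \int[P]_x (h x)%:E <= 1)
  (FGh : forall x, F x <= (G x + h x - 1)%:E).

Let int_h_fin : \int[P]_x (h x)%:E < +oo.
Proof. exact: le_lt_trans int_h (ltry _). Qed.

Let integrable_h : P.-integrable setT (EFin \o h).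
Proof.
apply/integrableP; split; first exact/measurable_EFinP.
by under eq_integral do rewrite /= ger0_norm//.
Qed.

Let k x : R := (G x + h x - 1)%R.

Let measurable_G : measurable_fun setT (EFin \o G).
Proof. exact/measurable_EFinP. Qed.

Let measurable_h : measurable_fun setT (EFin \o h).
Proof. exact/measurable_EFinP. Qed.

(** Since [P] has mass 1, [int_h] says that [h - 1] has integral at most 0. *)
Let integrable_k : P.-integrable setT (EFin \o G) ->
  P.-integrable setT (EFin \o k) /\
  \int[P]_x (k x)%:E <= \int[P]_x (G x)%:E.
Proof.
move=> iG; have i1 : P.-integrable setT (EFin \o cst 1%R).
  exact: finite_measure_integrable_cst.
have int1 : \int[P]_x (EFin \o cst 1%R) x = 1.
  rewrite -[LHS]/(\int[P]_x cst 1 x) integral_cst// mul1e.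
  exact: probability_setT.
have kE : EFin \o k = ((EFin \o G) \+ (EFin \o h)) \- (EFin \o cst 1%R).
  by apply/funext.
have iGh : P.-integrable setT ((EFin \o G) \+ (EFin \o h)).
  exact: integrableD.
split; first by rewrite kE; exact: integrableB.
rewrite -[X in integral _ _ X]/(EFin \o k) kE integralB// integralD//.
by rewrite int1 leeBlDr// leeD2l.
Qed.

Let int_Gneg : \int[P]_x F^\- x < +oo ->
  \int[P]_x (EFin \o G)^\- x < +oo.
Proof.
move=> Fn; apply: (@le_lt_trans _ _ (\int[P]_x (F^\- x + (h x)%:E))).
  apply: ge0_le_integral => //.
  - exact: measurable_funeneg.
  - by apply: emeasurable_funD => //; exact: measurable_funeneg.
  - move=> x _; rewrite !funenegE /=; have := FGh x; have := h0 x.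
    case: (F x) => [r| |]//= hx; last by rewrite maxye addye// leey.
    rewrite lee_fin => rx; rewrite -!EFin_max -EFinD lee_fin.
    rewrite /Num.max; do 2 case: ifP => ?; lra.
by rewrite ge0_integralD//; [exact: lte_add_pinfty|exact: measurable_funeneg|
  move=> x _; rewrite lee_fin].
Qed.

Let int_Fpos : \int[P]_x (EFin \o G)^\+ x < +oo -> \int[P]_x F^\+ x < +oo.
Proof.
move=> Gp; apply: (@le_lt_trans _ _ (\int[P]_x ((EFin \o G)^\+ x + (h x)%:E))).
  apply: ge0_le_integral => //.
  - exact: measurable_funepos.
  - by apply: emeasurable_funD => //; exact: measurable_funepos.
  - move=> x _; rewrite !funeposE /=; have := FGh x; have := h0 x.
    case: (F x) => [r| |]//= hx; last first.
      move=> _; rewrite maxNye -EFin_max -EFinD lee_fin /Num.max.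
      by case: ifP => ?; lra.
    rewrite lee_fin => rx; rewrite -!EFin_max -EFinD lee_fin.
    rewrite /Num.max; do 2 case: ifP => ?; lra.
by rewrite ge0_integralD//; [exact: lte_add_pinfty|exact: measurable_funepos|
  move=> x _; rewrite lee_fin].
Qed.

Lemma gibbs_inequality : \int[P]_x F x <= \int[P]_x (G x)%:E.
Proof.
(* [F^\-] is integrable as soon as [\int F > -oo], hence so is [G^\- <= F^\- + h]; then
   [\int G] is either [+oo] or finite, and [F^\+ <= G^\+ + h] makes [F] integrable. *)
have [Fn|] := ltP (\int[P]_x F^\- x) +oo; last first.
  by rewrite leye_eq => /eqP Fn; rewrite integralE Fn addeNy leNye.
have Gn := int_Gneg Fn.
have [Gp|] := ltP (\int[P]_x (EFin \o G)^\+ x) +oo; last first.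
  rewrite leye_eq => /eqP Gp.
  rewrite [leRHS]integralE Gp addye ?leey//.
  by rewrite eqe_oppLR/= lt_eqF.
have iG := integrable_of_posneg measurable_G Gp Gn.
have iF := integrable_of_posneg mF (int_Fpos Gp) Fn.
have [ik kG] := integrable_k iG.
by apply: le_trans kG; apply: le_integral => // x _; exact: FGh.
Qed.

Hypothesis FGh_eq : forall x, F x = (G x + h x - 1)%:E -> h x = 1%R.

(** Finiteness makes [F] and [G] integrable. Then [k - F] is nonnegative and its integral is at most
    that of [G - F], which is 0, so [F = k] almost everywhere and [FGh_eq] applies there. *)
Lemma gibbs_equality : \int[P]_x F x = \int[P]_x (G x)%:E ->
  \int[P]_x F x \is a fin_num -> ae_eq P setT h (cst 1%R).
Proof.
move=> FG finF.
have posneg_fin (f : T -> \bar R) : \int[P]_x f x \is a fin_num ->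
    \int[P]_x f^\+ x < +oo /\ \int[P]_x f^\- x < +oo.
  rewrite integralE fin_numB => /andP[].
  by rewrite !ge0_fin_numE// integral_ge0.
have [Fp Fn] := posneg_fin _ finF.
have [Gp Gn] := posneg_fin (EFin \o G) ltac:(by rewrite -FG).
have iG := integrable_of_posneg measurable_G Gp Gn.
have iF := integrable_of_posneg mF Fp Fn.
have [ik kG] := integrable_k iG.
have kF : \int[P]_x ((EFin \o k) \- F) x = 0.
  apply/eqP; rewrite eq_le; apply/andP; split.
    by rewrite integralB// sube_le0 FG.
  by apply: integral_ge0 => x _; rewrite sube_ge0 ?orbT//; exact: FGh.
have : ae_eq P setT ((EFin \o k) \- F) (cst 0).
  apply/ae_eq_integral_abs => //.
    by apply: emeasurable_funB => //; exact: measurable_int ik.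
  rewrite -[RHS]kF; apply: eq_integral => x _; rewrite gee0_abs//.
  by rewrite sube_ge0 ?orbT//; exact: FGh.
apply: filterS => x /= /(_ Logic.I) kx _; apply: FGh_eq.
move: kx; rewrite /k; case: (F x) => [r| |]//=; rewrite -EFinB => -[] /eqP.
by rewrite subr_eq0 => /eqP ->.
Qed.

End gibbs.

(** * The extended logarithm and its tangent bound *)

Section lne_bounds.
Context (R : realType).

Lemma measurable_lne : measurable_fun setT (@lne R).
Proof.
(* [fine] sends both infinities to 0: [+oo] is therefore tested first, and [-oo] falls under the
   second test. *)
rewrite (_ : @lne R = fun x => if x == +oo then +oo
    else if (fine x <= 0)%R then -oo else (ln (fine x))%:E); last first.
  apply/funext => -[r| |]//=.
  by rewrite lexx.
apply: measurable_fun_ifT => //.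
  apply: (measurable_fun_bool true); rewrite setTI.
  rewrite (_ : _ @^-1` _ = [set +oo]); first exact: emeasurable_set1.
  by apply/seteqP; split=> x /= => [/eqP|->].
apply: measurable_fun_ifT => //.
  exact: measurable_fun_ler.
by apply/measurable_EFinP; exact: measurableT_comp.
Qed.

Lemma ln_le_subr1 (x : R) : (0 < x -> ln x <= x - 1)%R.
Proof.
by move=> x0; have := @expR_ge1Dx R (ln x); rewrite lnK ?posrE//; lra.
Qed.

(** The bound [1 + y < expR y] is strict for nonzero [y]; at [y = ln x] this leaves only
    [ln x = 0]. *)
Lemma ln_eq_subr1 (x : R) : (0 < x -> ln x = x - 1 -> x = 1)%R.
Proof.
move=> x0 lnx; have [l0|/expR_gt1Dx] := eqVneq (ln x) 0%R; first lra.
by rewrite lnK ?posrE// lnx; lra.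
Qed.

End lne_bounds.

(** * Comparison of log-likelihoods through densities *)

Section log_likelihood.
Context d (T : measurableType d) (R : realType).
Context (lam : {sigma_finite_measure set T -> \bar R}) (P p : probability T R).
Hypotheses (Plam : P `<< lam) (plam : p `<< lam).

(* Unlike ['d _ '/d lam], which may be negative on a null set, these densities are
   nonnegative and finite at every point. *)
Let g : T -> \bar R := Radon_Nikodym_SigmaFinite.f P lam.
Let f : T -> \bar R := Radon_Nikodym_SigmaFinite.f p lam.

Let measurable_density (nu : probability T R) : nu `<< lam ->
  measurable_fun setT (Radon_Nikodym_SigmaFinite.f nu lam).
Proof.
move=> nulam.
exact: measurable_int (Radon_Nikodym_SigmaFinite.f_integrable nulam).
Qed.

Let mg : measurable_fun setT g. Proof. exact: measurable_density. Qed.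
Let mf : measurable_fun setT f. Proof. exact: measurable_density. Qed.
Let g0 x : 0 <= g x. Proof. exact: Radon_Nikodym_SigmaFinite.f_ge0. Qed.
Let f0 x : 0 <= f x. Proof. exact: Radon_Nikodym_SigmaFinite.f_ge0. Qed.
Let gfin x : g x \is a fin_num.
Proof. exact: Radon_Nikodym_SigmaFinite.f_fin_num. Qed.
Let ffin x : f x \is a fin_num.
Proof. exact: Radon_Nikodym_SigmaFinite.f_fin_num. Qed.

Let gR x : R := fine (g x).
Let fR x : R := fine (f x).
Let mgR : measurable_fun setT gR. Proof. exact: measurableT_comp. Qed.
Let mfR : measurable_fun setT fR. Proof. exact: measurableT_comp. Qed.
Let gR0 x : (0 <= gR x)%R. Proof. exact: fine_ge0. Qed.
Let fR0 x : (0 <= fR x)%R. Proof. exact: fine_ge0. Qed.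

Let mpos : measurable_fun setT (fun x => 0 < gR x)%R.
Proof. exact: measurable_fun_ltr. Qed.

(* [f / g] on [g > 0], written with [expR] and [ln] because inversion on [R] has no
   measurability lemma *)
Let ratio x : R := if (0 < gR x)%R then (fR x * expR (- ln (gR x)))%R else 0%R.

Let ratioE x : (0 < gR x)%R -> ratio x = (fR x / gR x)%R.
Proof. by move=> gx; rewrite /ratio gx expRN lnK. Qed.

Let ratio0 x : (0 <= ratio x)%R.
Proof. by rewrite /ratio; case: ifP => // _; rewrite mulr_ge0// expR_ge0. Qed.

Let measurable_ratio : measurable_fun setT ratio.
Proof.
apply: measurable_fun_ifT => //; apply: measurable_funM => //.
apply: measurableT_comp => //; apply: measurableT_comp => //.
exact: (measurableT_comp (@measurable_ln R) mgR).
Qed.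

(** Equality holds where [g] is positive; where [g] vanishes, [ratio] is 0 while [f] may be
    positive. *)
Let ratio_mul x : (ratio x)%:E * g x <= f x.
Proof.
rewrite -(fineK (gfin x)) -(fineK (ffin x)) -/(gR x) -/(fR x) -EFinM lee_fin.
have [gx|gx] := ltP 0%R (gR x); first by rewrite ratioE// divfK// gt_eqF.
by rewrite /ratio ltNge gx/= mul0r.
Qed.

(** As [P] has density [g], the left side is the integral of [ratio * g] against [lam], and
    [ratio_mul] bounds it by that of [f]. *)
Let integral_ratio A : measurable A -> \int[P]_(x in A) (ratio x)%:E <= p A.
Proof.
move=> mA; rewrite -(Radon_Nikodym_SigmaFinite.change_of_variables Plam)//.
- rewrite (Radon_Nikodym_SigmaFinite.f_integral plam)//.
  apply: ge0_le_integral => //.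
  + by move=> x _; rewrite mule_ge0 ?lee_fin//; exact: g0.
  + apply: measurable_funTS; apply: emeasurable_funM => //.
    exact/measurable_EFinP.
  + exact: measurable_funTS.
- by apply: measurable_funTS; exact/measurable_EFinP.
Qed.

Let ae_pos : \forall x \ae P, (0 < gR x)%R.
Proof.
have mN : measurable [set x | ~ (0 < gR x)%R].
  rewrite (_ : [set _ | _] = ~` ((fun x => 0 < gR x)%R @^-1` [set true]))//.
  by apply: measurableC; rewrite -[X in measurable X]setTI; exact: mpos.
exists [set x | ~ (0 < gR x)%R]; split => //.
rewrite [LHS](Radon_Nikodym_SigmaFinite.f_integral Plam)//.
apply: integral0_eq => x /= /negP; rewrite -leNgt -/(g x) => gx.
by apply/eqP; rewrite eq_le g0 andbT -(fineK (gfin x)) lee_fin.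
Qed.

(* [F] and [G] are versions of [lne f] and [lne g] for which the bound [FGle]
   holds at every point. *)
Let F x : \bar R := if (0 < gR x)%R then lne (f x) else -oo.
Let G x : R := ln (gR x).

Let mF : measurable_fun setT F.
Proof.
apply: measurable_fun_ifT => //.
by apply: measurableT_comp => //; exact: measurable_lne.
Qed.

Let mG : measurable_fun setT G.
Proof. exact: (measurableT_comp (@measurable_ln R) mgR). Qed.

Let lneE x : (0 < gR x)%R -> (0 < fR x)%R ->
  lne (f x) = (G x + ln (ratio x))%:E.
Proof.
move=> gx fx; rewrite -(fineK (ffin x)) lne_EFin// ratioE// ln_div ?posrE//.
by rewrite /G addrC subrK.
Qed.

(** Where [f] or [g] vanishes [F] is [-oo]; elsewhere this is [ln t <= t - 1] at [t = f / g]. *)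
Let FGle x : F x <= (G x + ratio x - 1)%:E.
Proof.
rewrite /F; case: ifPn => [gx|_]; last exact: leNye.
have [fx|fx] := ltP 0%R (fR x).
  rewrite lneE// lee_fin -addrA lerD2l ln_le_subr1//.
  by rewrite ratioE// divr_gt0.
by rewrite le0_lneNy ?leNye// -(fineK (ffin x)) lee_fin.
Qed.

Let FGeq x : F x = (G x + ratio x - 1)%:E -> ratio x = 1%R.
Proof.
rewrite /F; case: ifPn => [gx|//].
have [fx|fx] := ltP 0%R (fR x); last first.
  by rewrite le0_lneNy// -(fineK (ffin x)) lee_fin.
rewrite lneE// -addrA => -[/addrI]; apply: ln_eq_subr1.
by rewrite ratioE// divr_gt0.
Qed.

(** The two densities agree [lam]-almost everywhere, hence [P]-almost everywhere by [Plam]. *)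
Let integral_lne (nu : probability T R) : nu `<< lam ->
  \int[P]_x lne (Radon_Nikodym (charge_of_finite_measure nu) lam x) =
  \int[P]_x lne (Radon_Nikodym_SigmaFinite.f nu lam x).
Proof.
move=> nulam; apply: ae_eq_integral => //.
- apply: measurableT_comp; first exact: measurable_lne.
  by apply: measurable_int; exact: Radon_Nikodym_integrable.
- by apply: measurableT_comp; [exact: measurable_lne|exact: measurable_density].
- apply: (null_dominates_ae_eq measurableT Plam).
  have := ae_eq_Radon_Nikodym_SigmaFinite nulam measurableT.
  by apply: filterS => x /= /[apply] ->.
Qed.

Let int_F : \int[P]_x lne (Radon_Nikodym (charge_of_finite_measure p) lam x) =
  \int[P]_x F x.
Proof.
rewrite integral_lne//; apply: ae_eq_integral => //.
  by apply: measurableT_comp => //; exact: measurable_lne.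
by apply: filterS ae_pos => x gx _; rewrite /F gx.
Qed.

Let int_G : \int[P]_x lne (Radon_Nikodym (charge_of_finite_measure P) lam x) =
  \int[P]_x (G x)%:E.
Proof.
rewrite integral_lne//; apply: ae_eq_integral => //.
- by apply: measurableT_comp => //; exact: measurable_lne.
- exact/measurable_EFinP.
by apply: filterS ae_pos => x gx _; rewrite -lne_EFin// fineK.
Qed.

Let int_ratio : \int[P]_x (ratio x)%:E <= 1.
Proof.
by apply: le_trans (integral_ratio measurableT) _; rewrite probability_setT.
Qed.

Lemma log_likelihood_le :
  \int[P]_x lne (Radon_Nikodym (charge_of_finite_measure p) lam x) <=
  \int[P]_x lne (Radon_Nikodym (charge_of_finite_measure P) lam x).
Proof. by rewrite int_F int_G; exact: (@gibbs_inequality _ _ _ P F G ratio). Qed.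

Lemma log_likelihood_eq :
    \int[P]_x lne (Radon_Nikodym (charge_of_finite_measure p) lam x) =
    \int[P]_x lne (Radon_Nikodym (charge_of_finite_measure P) lam x) ->
    \int[P]_x lne (Radon_Nikodym (charge_of_finite_measure p) lam x) \is a fin_num ->
  forall A, measurable A -> p A = P A.
Proof.
rewrite int_F int_G => FG finF.
have h1 : ae_eq P setT ratio (cst 1%R) by exact: (@gibbs_equality _ _ _ P F G ratio).
have Pp A : measurable A -> P A <= p A.
  move=> mA; apply: le_trans (integral_ratio mA).
  rewrite (@ae_eq_integral _ _ _ P A (cst 1))//.
  - by rewrite integral_cst// mul1e.
  - by apply: measurable_funTS; exact/measurable_EFinP.
  - by apply: filterS h1 => x /= /(_ Logic.I) -> _.
(* Both masses being 1, [Pp] on the complement of [A] gives the reverse inequality. *)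
move=> A mA; apply/eqP; rewrite eq_le Pp// andbT.
have := Pp _ (measurableC mA); rewrite !probability_setC//.
rewrite -(fineK (fin_num_measure P _ mA)) -(fineK (fin_num_measure p _ mA)).
by rewrite -!EFinB !lee_fin lerD2l lerN2.
Qed.

End log_likelihood.

(** [PI] speaks of nonnegative functions only; [integral_mixture] extends it to the log-density,
    which can take both signs. *)
Lemma mstep_objectiveE (R : realType) (d1 d2 : nat) (S : 'I_d2 -> pointedFinType)
    (M : {set mask_vec d1 d2}) (mu : mask_dist R M)
    (mu_pos : forall m, m \in M -> (0 < mu m)%R)
    (pstar P p : probability (data_space R d1 S) R)
    (q : forall m : mask_vec d1 d2, R.-pker observed R S m ~> missing R S m)
    (PI : forall f, measurable_fun setT f -> (forall x, 0 <= f x) ->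
      \int[P]_x f x =
        \sum_(m in M) (mu m)%:E * \int[completed_law pstar (q m)]_x f x)
    (lam : {sigma_finite_measure set (data_space R d1 S) -> \bar R}) :
  p `<< lam ->
  mstep_objective mu pstar q lam p =
  \int[P]_x lne (Radon_Nikodym (charge_of_finite_measure p) lam x).
Proof.
move=> plam.
apply: (@integral_mixture _ _ _ _ M mu (fun m => completed_law pstar (q m)) P) => //.
apply: measurableT_comp; first exact: measurable_lne.
by apply: measurable_int; exact: Radon_Nikodym_integrable.
Qed.

Theorem proposition1 (R : realType) (d1 d2 : nat) (S : 'I_d2 -> pointedFinType)
    (M : {set mask_vec d1 d2}) (mu : mask_dist R M)
    (mu_pos : forall m, m \in M -> (0 < mu m)%R)
    (pstar pn : probability (data_space R d1 S) R)
    (q : forall m : mask_vec d1 d2, R.-pker observed R S m ~> missing R S m)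
    (Estep : forall m, m \in M -> is_conditional pn (q m)) :
  exists pnext : probability (data_space R d1 S) R,
    [/\ (forall A, measurable A -> pnext A = impute_em_update mu pstar q A),
        ((forall m, m \in M -> marginal pstar m `<< marginal pn m) ->
         forall q' : forall m : mask_vec d1 d2,
             R.-pker observed R S m ~> missing R S m,
           (forall m, m \in M -> is_conditional pn (q' m)) ->
           forall A, measurable A -> pnext A = impute_em_update mu pstar q' A) &
        (forall lam : {sigma_finite_measure set (data_space R d1 S) -> \bar R},
           pnext `<< lam ->
           is_mstep mu pstar q lam pnext /\
           (forall p : probability (data_space R d1 S) R,
              is_mstep mu pstar q lam p ->
              mstep_objective mu pstar q lam p \is a fin_num ->
              forall A, measurable A -> p A = pnext A))].

Proof.
have [P [PE PI]] := mixture_probability (fun m => completed_law pstar (q m))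
  (@mask_weight_ge0 _ _ _ M mu) (mask_weight_sum1 mu).
exists P; split=> [A _|dom q' Estep' A mA|lam Plam].
- exact: PE.
- rewrite PE; apply: eq_bigr => m mM; congr (_ * _).
  by apply: (eq_completed_law (Estep m mM) (Estep' m mM)) => //; exact: dom.
- have objE p := mstep_objectiveE (p := p) mu_pos PI.
  have stepP : is_mstep mu pstar q lam P.
    by split=> // p plam; rewrite !objE//; exact: log_likelihood_le.
  split=> // p [plam p_max] pfin; apply: (log_likelihood_eq Plam plam).
    (* Each of [p] and [P] maximizes the objective and is a competitor for the other, so the two
       values coincide. *)
    rewrite -!objE//; apply/eqP; rewrite eq_le p_max// andbT.
    by case: stepP => _; exact.
  by rewrite -objE.
Qed.
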